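(* Let $F:X\to\mathcal P(X)$ be (the generator of) a discrete multivalued dynamical system on a topological space $X$, and let $N\subset X$ be an isolating neighbourhood for $F$. Then for every neighbourhood $W$ of $\operatorname{Inv}N$ there exists a weak index pair $P=(P_1,P_2)$ in $N$ such that $P_1\setminus P_2\subset W$.
   Context: $\mathcal P(X)$ is the set of all subsets of $X$; $\operatorname{int}$, $\operatorname{cl}$ denote interior and closure in $X$. A map $G:Y\to\mathcal P(X)$ is upper semicontinuous (usc) if $\{y\in Y\mid G(y)\cap B\neq\varnothing\}$ is closed for every closed $B\subset X$; $G(A)=\bigcup_{y\in A}G(y)$. A discrete multivalued dynamical system (dmds) is a usc map $F:X\times\mathbb Z\to\mathcal P(X)$ with compact values such that (i) $F(x,0)=\{x\}$ for all $x$; (ii) $F(F(x,n),m)=F(x,n+m)$ for all $x$ and all $n,m\in\mathbb Z$ with $nm\ge 0$; (iii) $y\in F(x,-1)\Leftrightarrow x\in F(y,1)$ for all $x,y$. The dmds is identified with its generator $F(x):=F(x,1)$. For an interval $I\subset\mathbb Z$ containing $0$, a solution for $F$ through $x$ is a map $\sigma:I\to X$ with $\sigma(0)=x$ and $\sigma(n+1)\in F(\sigma(n))$ whenever $n,n+1\in I$. For $N\subset X$, $\operatorname{Inv}N$ is the set of $x\in N$ for which there is a solution $\sigma:\mathbb Z\to N$ for $F$ through $x$. A compact set $N\subset X$ is an isolating neighbourhood for $F$ if $\operatorname{Inv}N\subset\operatorname{int}N$. For $A\subset X$ let $\operatorname{bd}_F(A):=\operatorname{cl}A\cap\operatorname{cl}(F(A)\setminus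 A)$. A weak index pair in $N$ is a pair $P=(P_1,P_2)$ of compact sets $P_2\subset P_1\subset N$ such that (a) $F(P_i)\cap N\subset P_i$ for $i=1,2$; (b) $\operatorname{bd}_F(P_1)\subset P_2$; (c) $\operatorname{Inv}N\subset\operatorname{int}(P_1\setminus P_2)$; (d) $P_1\setminus P_2\subset\operatorname{int}N$.
   Formalization: The space X is additionally assumed to be Hausdorff; for arbitrary topological spaces the claim fails (there is a five-point non-Hausdorff counterexample). *)

(* Defs.v *)
(* The library's [compact] does not include the Hausdorff
   axiom, so separation has to be assumed separately: over a finite non-T1
   space, where every set is compact, a weak index pair P with P1 `\` P2 inside
   a prescribed neighbourhood of the invariant part of N need not exist. *)
From HB Require Import structures.
From mathcomp Require Import all_boot all_order all_algebra.
From mathcomp Require Import all_classical topology.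

Set Implicit Arguments.
Unset Strict Implicit.
Unset Printing Implicit Defensive.

Import Order.TTheory GRing.Theory Num.Theory.
Local Open Scope classical_set_scope.
Local Open Scope ring_scope.

Definition mimage {X Y : Type} (G : Y -> set X) (A : set Y) : set X :=
  \bigcup_(y in A) G y.

Definition usc {X Y : topologicalType} (G : Y -> set X) : Prop :=
  forall B : set X, closed B -> closed [set y | G y `&` B !=set0].

(* X * Z carries the product topology, Z being discrete. *)
Record is_dmds {X : topologicalType}
    (Phi : X * discrete_topology int -> set X) : Prop := IsDmds {
  dmds_usc : usc Phi;
  dmds_compact : forall z, compact (Phi z);
  dmds_id : forall x, Phi (x, 0 : int) = [set x];
  dmds_comp : forall (x : X) (n m : int), 0 <= n * m ->
    mimage (fun y => Phi (y, m)) (Phi (x, n)) = Phi (x, n + m);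
  dmds_inv : forall x y, Phi (x, -1 : int) y <-> Phi (y, 1 : int) x }.

Definition generator {X : topologicalType}
    (Phi : X * discrete_topology int -> set X) : X -> set X :=
  fun x => Phi (x, 1 : int).

(* A solution is only constrained on the interval I; its values off I are
   irrelevant. *)
Definition solution {X : Type} (F : X -> set X) (I : interval int) (x : X)
    (sigma : int -> X) : Prop :=
  [/\ 0 \in I, sigma 0 = x
    & forall n : int, n \in I -> n + 1 \in I -> F (sigma n) (sigma (n + 1))].

Definition inv_part {X : Type} (F : X -> set X) (N : set X) : set X :=
  [set x | N x /\ exists sigma : int -> X,
     (forall n, N (sigma n)) /\ solution F `]-oo, +oo[ x sigma].

Definition isolating_neighbourhood {X : topologicalType} (F : X -> set X)
    (N : set X) : Prop :=
  compact N /\ inv_part F N `<=` interior N.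

Definition bdF {X : topologicalType} (F : X -> set X) (A : set X) : set X :=
  closure A `&` closure (mimage F A `\` A).

Record weak_index_pair {X : topologicalType} (F : X -> set X) (N : set X)
    (P : set X * set X) : Prop := WeakIndexPair {
  wip_compact1 : compact P.1;
  wip_compact2 : compact P.2;
  wip_sub21 : P.2 `<=` P.1;
  wip_sub1N : P.1 `<=` N;
  wip_pos1 : mimage F P.1 `&` N `<=` P.1;
  wip_pos2 : mimage F P.2 `&` N `<=` P.2;
  wip_bd : bdF F P.1 `<=` P.2;
  wip_inv : inv_part F N `<=` interior (P.1 `\` P.2);
  wip_int : P.1 `\` P.2 `<=` interior N }.

(* Main.v *)
Require Import Defs.
From HB Require Import structures.
From mathcomp Require Import all_boot all_order all_algebra.
From mathcomp Require Import all_classical topology.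

(** Write tails for the set of points of N at which arbitrarily long solution
    segments in N end, and heads for those at which such segments start. By
    compactness (Koenig's lemma, [tails_pred] and [heads_succ]) these are the
    points with an infinite backward, resp. forward, solution in N, and gluing
    the two halves gives Inv N = tails `&` heads ([inv_partE]). Fix an open U
    with Inv N `<=` U `<=` int N `&` W.

    The pair consists of the forward orbits, inside N, of two suitable sets.
    - P1 is the orbit of a compact neighbourhood A, relative to N, of tails.
      Such an orbit is compact, because its late parts accumulate only on
      tails, which is contained in A ([compact_orbit_tails]). Moreover tails
      misses the compact set heads `\` U, and if A is small enough then so does
      P1 ([exists_stable_neighbourhood]): the late parts of the orbit are close
      to tails whatever A is, so A only has to avoid finitely many closed sets.
    - P2 is the orbit of P1 `\` U. The latter misses heads, so all its points
      leave N within a common time and its orbit is a finite union of compact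
      sets ([compact_orbit_disjoint_heads]). This orbit still misses heads: a
      point that can reach heads inside N is itself in heads.
    Then P1 `\` P2 `<=` U by construction, Inv N lies in the interior of P1 and
    off the closed set P2, and a point of U is interior to N, hence cannot be a
    limit of points of F(P1) `\` P1, which lie outside N; so bd_F(P1) `<=`
    P1 `\` U `<=` P2. *)

Set Implicit Arguments.
Unset Strict Implicit.
Unset Printing Implicit Defensive.

Local Open Scope classical_set_scope.

(** * Compactness *)

(** Finite intersection property, for a family directed by reverse inclusion.
    This single form serves decreasing sequences (indexed by nat), filters
    (indexed by their own members) and neighbourhoods of a set. *)
Lemma compact_directed_bigcap {X : topologicalType} {I : Type} (D : set I)
    (B : I -> set X) (K : set X) :
    compact K -> (exists i, D i) ->
    (forall i j, D i -> D j -> exists2 k, D k & B k `<=` B i `&` B j) ->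
    (forall i, D i -> K `&` B i !=set0) ->
  exists2 x, K x & forall i, D i -> closure (B i) x.
Proof.
move=> cK [i0 Di0] dirB KB.
have fG : Filter (filter_from D (fun i => K `&` B i)).
  apply: filter_from_filter; first by exists i0.
  move=> i j Di Dj; have [k Dk kij] := dirB _ _ Di Dj; exists k => //.
  by move=> x [Kx /kij [Bi Bj]].
have pG := filter_from_proper fG KB.
have [|x [Kx]] := cK _ pG; first by exists i0 => // x [].
rewrite clusterE => clx; exists x => // i Di.
suff : closure (K `&` B i) x by apply: closureS => y [].
by apply: clx; exists i.
Qed.

Lemma compact_decreasing_bigcap {X : topologicalType} (C : nat -> set X)
    (K : set X) :
    compact K -> (forall n, closed (C n)) ->
    (forall n, C n.+1 `<=` C n) -> (forall n, K `&` C n !=set0) ->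
  K `&` \bigcap_n C n !=set0.
Proof.
move=> cK cC dC KC.
have CC n m : (n <= m)%N -> C m `<=` C n.
  elim: m => [|m IH]; first by rewrite leqn0 => /eqP ->.
  rewrite leq_eqVlt => /predU1P [->//|nm].
  exact: subset_trans (dC m) (IH nm).
have [|||x Kx clx] := @compact_directed_bigcap X nat setT C K cK.
- by exists 0%N.
- move=> i j _ _; exists (maxn i j) => // x Cx; split; apply: CC Cx;
  by rewrite ?leq_maxl ?leq_maxr.
- by move=> n _; exact: KC.
exists x; split => // n _; rewrite ((closure_id _).1 (cC n)); exact: clx.
Qed.

(** Two applications of compactness: first to L, against the closures of the
    neighbourhoods of K, then to K, against the closures of the neighbourhoods
    of the point of L so obtained. *)
Lemma compact_separation {X : topologicalType} (hX : hausdorff_space X)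
    (K L : set X) :
    compact K -> compact L -> K `&` L = set0 ->
  exists O, [/\ open O, K `<=` O & L `&` closure O = set0].
Proof.
move=> cK cL KL; apply: contrapT => noO.
have [|||y Ly cly] := @compact_directed_bigcap X (set X)
    [set O | open O /\ K `<=` O] closure L cL.
- by exists setT; split => //; exact: openT.
- move=> O1 O2 [o1 k1] [o2 k2]; exists (O1 `&` O2); last exact: closureI.
  by split; [exact: openI|move=> x Kx; split; [exact: k1|exact: k2]].
- move=> O [oO KO]; apply/set0P/eqP => LO; apply: noO; by exists O.
have {}cly O : open O -> K `<=` O -> closure O y.
  move=> oO KO; rewrite ((closure_id _).1 (@closed_closure _ O)).
  by apply: cly; split.
have [|||x Kx clx] := @compact_directed_bigcap X (set X)
    (nbhs y) closure K cK.
- by exists setT; exact: filterT.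
- move=> V1 V2 V1y V2y; exists (V1 `&` V2); last exact: closureI.
  exact: filterI.
- move=> V Vy; apply: contrapT => /set0P/negP/negPn/eqP KV.
  have [||z [/= nVz /subset_closure //]] := cly (~` closure V) _ _ V Vy.
    by apply: closed_openC; exact: closed_closure.
  by move=> z Kz Vz; rewrite -[False]/(set0 z) -KV.
have yx : y = x.
  apply: hX; rewrite clusterE => V Vy.
  by rewrite ((closure_id _).1 (@closed_closure _ V)); exact: clx.
by rewrite -[False]/(set0 x) -KL; split => //; rewrite -yx.
Qed.

(** The required cluster point is found first in the domain, as a point x of K
    whose value meets the closure of every member of the filter, and then in the
    compact value G x. *)
Lemma compact_mimage {X Y : topologicalType} (G : Y -> set X) (K : set Y) :
  usc G -> (forall y, compact (G y)) -> compact K -> compact (mimage G K).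
Proof.
move=> uG cG cK H pH HK.
have [|||x Kx clx] := @compact_directed_bigcap Y (set X) H
    (fun M => [set y | G y `&` closure M !=set0]) K cK.
- by exists setT; exact: filterT.
- move=> M1 M2 HM1 HM2; exists (M1 `&` M2); first exact: filterI.
  by move=> y [z [Gz /closureI [cl1 cl2]]]; split; exists z.
- move=> M HM; have [z [[y Ky Gyz] Mz]] := filter_ex (filterI HK HM).
  by exists y; split => //; exists z; split => //; exact: subset_closure.
have [|||z Gz clz] := @compact_directed_bigcap X (set X) H closure (G x) (cG x).
- by exists setT; exact: filterT.
- move=> M1 M2 HM1 HM2; exists (M1 `&` M2); last exact: closureI.
  exact: filterI.
- move=> M HM; move: (clx M HM).
  by rewrite -(closure_id _).1 //; apply: uG; exact: closed_closure.
exists z; split; first by exists x.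
rewrite clusterE => M HM.
by rewrite ((closure_id _).1 (@closed_closure _ M)); exact: clz.
Qed.

(** * Forward and backward iterates inside N *)

Section Iterates.
Context {X : topologicalType} (F : X -> set X) (N : set X).

Definition fwd (A : set X) : set X := mimage F A `&` N.
Definition bwd (B : set X) : set X := N `&` [set x | F x `&` B !=set0].
Definition orbit (A : set X) : set X := \bigcup_k iter k fwd A.

(** iter n fwd N consists of the points at which a solution segment of length n
    in N ends, iter n bwd N of those at which one starts. When N is compact and F
    is usc with compact values and compact fibres, tails and heads are therefore
    the sets usually written Inv^- N and Inv^+ N. *)
Definition tails : set X := \bigcap_n iter n fwd N.
Definition heads : set X := \bigcap_n iter n bwd N.

Lemma fwdS (A B : set X) : A `<=` B -> fwd A `<=` fwd B.
Proof.
by move=> AB y [[x Ax Fxy] Ny]; split => //; exists x => //; exact: AB.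
Qed.

Lemma bwdS (A B : set X) : A `<=` B -> bwd A `<=` bwd B.
Proof.
by move=> AB x [Nx [y [Fxy Ay]]]; split => //; exists y; split => //; exact: AB.
Qed.

Lemma iter_fwdS k (A B : set X) : A `<=` B -> iter k fwd A `<=` iter k fwd B.
Proof. by move=> AB; elim: k => //= k; exact: fwdS. Qed.

Lemma iter_bwdS k (A B : set X) : A `<=` B -> iter k bwd A `<=` iter k bwd B.
Proof. by move=> AB; elim: k => //= k; exact: bwdS. Qed.

Lemma iter_fwd_sub k (A : set X) : A `<=` N -> iter k fwd A `<=` N.
Proof. by move=> AN; case: k => //= k x []. Qed.

Lemma iter_bwd_sub k (A : set X) : A `<=` N -> iter k bwd A `<=` N.
Proof. by move=> AN; case: k => //= k x []. Qed.

Lemma iter_fwd_stable k (A B : set X) :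
  A `<=` B -> fwd B `<=` B -> iter k fwd A `<=` B.
Proof.
move=> AB BB; elim: k => //= k IH.
exact: subset_trans (fwdS IH) BB.
Qed.

Lemma iter_bwd_stable k (A B : set X) :
  A `<=` B -> bwd B `<=` B -> iter k bwd A `<=` B.
Proof.
move=> AB BB; elim: k => //= k IH.
exact: subset_trans (bwdS IH) BB.
Qed.

Lemma iter_fwd_decr n : iter n.+1 fwd N `<=` iter n fwd N.
Proof. by rewrite iterSr; apply: iter_fwdS => x []. Qed.

Lemma iter_bwd_decr n : iter n.+1 bwd N `<=` iter n bwd N.
Proof. by rewrite iterSr; apply: iter_bwdS => x []. Qed.

(** A solution segment of length k from A to B can be read from either end. *)
Lemma iter_fwd_bwd k (A B : set X) : A `<=` N -> B `<=` N ->
  iter k fwd A `&` B !=set0 <-> A `&` iter k bwd B !=set0.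
Proof.
move=> AN; elim: k B => // k IH B BN.
rewrite [iter k.+1 bwd B]iterSr -IH; last by move=> x [].
split=> /=.
  case=> y [[[x Ax Fxy] Ny] By]; exists x; split => //.
  by split; [exact: iter_fwd_sub Ax|exists y].
case=> x [Ax [_ [y [Fxy By]]]]; exists y; split => //.
by split; [exists x|exact: BN].
Qed.

Lemma iter_disjoint k (A B : set X) : A `<=` N -> B `<=` N ->
  iter k fwd A `&` B = set0 <-> A `&` iter k bwd B = set0.
Proof.
move=> AN BN; have [h1 h2] := iter_fwd_bwd k AN BN.
split=> e; apply/eqP/negPn/negP => /set0P; [move/h2|move/h1].
  by rewrite e => -[].
by rewrite e => -[].
Qed.

Lemma tails_sub : tails `<=` N.
Proof. by move=> x /(_ 0%N I). Qed.

Lemma heads_sub : heads `<=` N.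
Proof. by move=> x /(_ 0%N I). Qed.

Lemma fwd_tails : fwd tails `<=` tails.
Proof.
move=> y Fy n _; apply: iter_fwd_decr => /=.
by apply: fwdS Fy => x; exact.
Qed.

Lemma bwd_heads : bwd heads `<=` heads.
Proof.
move=> y Fy n _; apply: iter_bwd_decr => /=.
by apply: bwdS Fy => x; exact.
Qed.

Lemma orbit_sub (A : set X) : A `<=` N -> orbit A `<=` N.
Proof. by move=> AN x [k _]; exact: iter_fwd_sub. Qed.

Lemma subset_orbit (A : set X) : A `<=` orbit A.
Proof. by move=> x Ax; exists 0%N. Qed.

Lemma fwd_orbit (A : set X) : fwd (orbit A) `<=` orbit A.
Proof.
by move=> y [[x [k _ kx] Fxy] Ny]; exists k.+1 => //; split => //; exists x.
Qed.

Lemma orbit_stable (A B : set X) :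
  A `<=` B -> fwd B `<=` B -> orbit A `<=` B.
Proof. by move=> AB BB x [k _]; exact: iter_fwd_stable. Qed.

Lemma orbit_split n (A : set X) :
  orbit A `<=` \bigcup_(k in `I_n) iter k fwd A `|` orbit (iter n fwd A).
Proof.
move=> x [k _ kx]; have [kn|nk] := ltnP k n; first by left; exists k.
by right; exists (k - n)%N => //; rewrite -iterD subnK.
Qed.

End Iterates.

Arguments tails_sub {X F N}.
Arguments heads_sub {X F N}.
Arguments iter_disjoint {X F N} k {A B}.

Section CompactIterates.
Context {X : topologicalType} (hX : hausdorff_space X).
Context (F : X -> set X) (N : set X).
Context (uF : usc F) (cF : forall x, compact (F x)).
Context (cFi : forall x, compact [set z | F z x]) (cN : compact N).

Local Notation fwd := (fwd F N).
Local Notation bwd := (bwd F N).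
Local Notation orbit := (orbit F N).
Local Notation tails := (tails F N).
Local Notation heads := (heads F N).

Lemma compact_iter_fwd k (A : set X) : compact A -> compact (iter k fwd A).
Proof.
move=> cA; elim: k => //= k IH.
by apply: compact_closedI; [exact: compact_mimage|exact: compact_closed].
Qed.

Lemma closed_iter_fwd k (A : set X) : compact A -> closed (iter k fwd A).
Proof. by move=> cA; apply: compact_closed => //; exact: compact_iter_fwd. Qed.

Lemma closed_iter_bwd k (B : set X) : closed B -> closed (iter k bwd B).
Proof.
move=> cB; elim: k => //= k IH.
by apply: closedI; [exact: compact_closed|exact: uF].
Qed.

Lemma closed_tails : closed tails.
Proof. by apply: closed_bigI => n _; exact: closed_iter_fwd. Qed.

Lemma closed_heads : closed heads.
Proof.
by apply: closed_bigI => n _; apply: closed_iter_bwd; exact: compact_closed.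
Qed.

(** The predecessors of x in the n-th forward iterate of N form, as n grows, a
    decreasing sequence of nonempty compact sets. *)
Lemma tails_pred x : tails x -> exists2 z, tails z & F z x.
Proof.
move=> tx.
have [||n|z [Fzx tz]] := compact_decreasing_bigcap
    (C := fun n => iter n fwd N) (@cFi x).
- by move=> n; exact: closed_iter_fwd.
- exact: iter_fwd_decr.
- by have [[z Cz Fzx] _] := tx n.+1 I; exists z.
- by exists z.
Qed.

Lemma heads_succ x : heads x -> exists2 z, heads z & F x z.
Proof.
move=> hx.
have [||n|z [Fxz tz]] := compact_decreasing_bigcap
    (C := fun n => iter n bwd N) (@cF x).
- by move=> n; apply: closed_iter_bwd; exact: compact_closed.
- exact: iter_bwd_decr.
- by have [_ [z [Fxz Cz]]] := hx n.+1 I; exists z.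
- by exists z.
Qed.

(** For every n, the orbit is the union of the closed sets iter k fwd A with
    k < n and of the orbit of iter n fwd A, so a limit point outside the orbit
    has to be a limit of arbitrarily late iterates. *)
Lemma closed_orbit (A : set X) : compact A ->
    (forall y, (forall n, closure (orbit (iter n fwd A)) y) -> orbit A y) ->
  closed (orbit A).
Proof.
move=> cA lim y cly; apply: contrapT => nOy.
apply: (nOy); apply: lim => n.
have /(closureS (@orbit_split X F N n A)) := cly; rewrite closureU => -[|//].
rewrite -(closure_id _).1; last first.
  apply: closed_bigcup; first exact: finite_II.
  by move=> k _; exact: closed_iter_fwd.
by move=> [k _ ky]; exfalso; apply: nOy; exists k.
Qed.

(** A limit of later and later iterates of A is in every closed set
    iter n fwd N, that is in tails, which A already contains. *)
Lemma compact_orbit_tails (A : set X) :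
  compact A -> A `<=` N -> tails `<=` A -> compact (orbit A).
Proof.
move=> cA AN tA; apply: subclosed_compact cN (orbit_sub AN).
apply: closed_orbit => // y cly; apply: subset_orbit; apply: tA => n _.
rewrite ((closure_id _).1 (@closed_iter_fwd n N cN)).
apply: closureS (cly n) => z [k _]; rewrite -iterD addnC iterD.
by apply: iter_fwdS; exact: iter_fwd_sub.
Qed.

(** By compactness all points of A leave N within a common number n of steps, so
    that iter n fwd A is empty and the orbit is a finite union. *)
Lemma compact_orbit_disjoint_heads (A : set X) :
  compact A -> A `<=` N -> A `&` heads = set0 -> compact (orbit A).
Proof.
move=> cA AN Ah; apply: subclosed_compact cN (orbit_sub AN).
have [n An] : exists n, A `&` iter n bwd N = set0.
  apply: contrapT => nA.
  have [|||x] := compact_decreasing_bigcap (C := fun n => iter n bwd N) cA.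
  - by move=> n; apply: closed_iter_bwd; exact: compact_closed.
  - exact: iter_bwd_decr.
  - by move=> n; apply/set0P/eqP => An; apply: nA; exists n.
  by rewrite -/heads Ah.
apply: closed_orbit => // y /(_ n) cly; exfalso; move: cly.
suff -> : iter n fwd A = set0.
  suff -> : orbit set0 = set0 by rewrite closure0.
  rewrite -subset0; apply: orbit_stable => // x [[z []]].
rewrite -subset0 -((iter_disjoint n AN (@subset_refl _ N)).2 An) => x Ax.
by split => //; exact: iter_fwd_sub Ax.
Qed.

(** A backward and a forward solution through x glue to a full one, since
    solutions of a multivalued map are only constrained step by step. *)
Lemma inv_partE : inv_part F N = tails `&` heads.
Proof.
rewrite eqEsubset; split.
  move=> x [Nx [s [Ns [_ <- sF]]]].
  have {}sF n : F (s n) (s (n + 1)%R) by apply: sF.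
  split=> n _.
    elim: n (0%R : int) => [|n IH] m /=; first exact: Ns.
    split; last exact: Ns.
    by exists (s (m - 1)%R); [exact: IH|rewrite -{2}(GRing.subrK 1%R m)].
  elim: n (0%R : int) => [|n IH] m /=; first exact: Ns.
  by split; [exact: Ns|exists (s (m + 1)%R)].
move=> x [tx hx]; split; first exact: tails_sub tx.
have [b bP] : {b : X -> X & forall x, tails x -> tails (b x) /\ F (b x) x}.
  apply: (@choice _ _ (fun x z => tails x -> tails z /\ F z x)) => y.
  have [/tails_pred [z tz Fzy]|nty] := pselect (tails y); first by exists z.
  by exists y => /nty.
have [f fP] : {f : X -> X & forall x, heads x -> heads (f x) /\ F x (f x)}.
  apply: (@choice _ _ (fun x z => heads x -> heads z /\ F x z)) => y.
  have [/heads_succ [z tz Fzy]|nty] := pselect (heads y); first by exists z.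
  by exists y => /nty.
have tb n : tails (iter n b x) by elim: n => //= n /bP [].
have hf n : heads (iter n f x) by elim: n => //= n /fP [].
(* Negz n stands for - n.+1, hence the extra iterate of b. *)
exists (fun n : int => match n with
  | Posz n => iter n f x | Negz n => iter n.+1 b x end).
split; first by case=> n; [exact: heads_sub (hf n)|exact: tails_sub (tb n.+1)].
split => // -[n|[|n]] _ _.
- by rewrite -PoszD addn1; have [] := fP _ (hf n).
- by have [] := bP _ tx.
- have -> : (Negz n.+1 + 1)%R = Negz n.
    by rewrite !NegzE -[n.+2]addn1 PoszD GRing.opprD GRing.subrK.
  by have [] := bP _ (tb n.+1).
Qed.

(** * The weak index pair *)

(** By compactness L misses iter n fwd N for some n; so no solution segment in N
    of length at least n ends in L, and the union has only finitely many
    nonempty terms. *)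
Lemma closed_orbit_meets (L : set X) :
    closed L -> L `<=` N -> tails `&` L = set0 ->
  closed (\bigcup_k iter k bwd L).
Proof.
move=> cL LN tL.
have [n Ln] : exists n, iter n fwd N `&` L = set0.
  apply: contrapT => nL.
  have [||||x] := compact_decreasing_bigcap
      (C := fun n => iter n fwd N) (K := L).
  - exact: subclosed_compact cN LN.
  - by move=> n; exact: closed_iter_fwd.
  - exact: iter_fwd_decr.
  - by move=> n; rewrite setIC; apply/set0P/eqP => Ln; apply: nL; exists n.
  by rewrite setIC -/tails tL.
have -> : \bigcup_k iter k bwd L = \bigcup_(k in `I_n) iter k bwd L.
  rewrite eqEsubset; split; last by move=> x [k _ kx]; exists k.
  move=> x [k _ kx]; exists k => //=; rewrite ltnNge; apply/negP => nk.
  have : N `&` iter k bwd L = set0.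
    apply/iter_disjoint => //; rewrite -subset0 -Ln => y [ky Ly]; split => //.
    move: ky; rewrite -(subnKC nk) iterD; apply: iter_fwdS.
    exact: iter_fwd_sub.
  by rewrite -subset0; apply; split; [exact: iter_bwd_sub kx|exact: kx].
apply: closed_bigcup; first exact: finite_II.
by move=> k _; exact: closed_iter_bwd.
Qed.

(** The set E of points whose orbit meets L is closed and, tails being forward
    invariant, disjoint from tails. So the orbit of any compact relative
    neighbourhood of tails that avoids E will do. *)
Lemma exists_stable_neighbourhood (L : set X) :
    closed L -> L `<=` N -> tails `&` L = set0 ->
  exists P O, [/\ compact P, P `<=` N, fwd P `<=` P, P `&` L = set0 &
    [/\ open O, tails `<=` O & O `&` N `<=` P]].
Proof.
move=> cL LN tL.
pose E := \bigcup_k iter k bwd L.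
have cE : closed E by exact: closed_orbit_meets.
have EN : E `<=` N by move=> x [k _]; exact: iter_bwd_sub.
have tE : E `&` tails = set0.
  rewrite -subset0 => x [[k _ kx] tx].
  have /(iter_disjoint k tails_sub LN) e : iter k fwd tails `&` L = set0.
    rewrite -subset0 -tL => y [ky Ly]; split => //; move: ky.
    by apply: iter_fwd_stable => //; exact: fwd_tails.
  by rewrite -e; split.
have [O [oO EO tO]] := compact_separation hX
  (subclosed_compact cE cN EN) (subclosed_compact closed_tails cN tails_sub) tE.
pose A := N `\` O.
have cA : compact A by apply: compact_closedI => //; exact: open_closedC.
have AN : A `<=` N by move=> x [].
exists (orbit A), (~` closure O); split.
- apply: compact_orbit_tails => // x tx; split; first exact: tails_sub tx.
  move=> Ox; rewrite -[False]/(set0 x) -tO; split => //.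
  exact: subset_closure.
- exact: orbit_sub.
- exact: fwd_orbit.
- rewrite -subset0 => x [[k _ kx] Lx].
  have /(iter_disjoint k AN LN) e : A `&` iter k bwd L = set0.
    by rewrite -subset0 => y [[_ nOy] ky]; apply: nOy; apply: EO; exists k.
  by rewrite -e; split.
split.
- by apply: closed_openC; exact: closed_closure.
- by move=> x tx Ox; rewrite -[False]/(set0 x) -tO.
- move=> x [nOx Nx]; apply: subset_orbit; split => // Ox; apply: nOx.
  exact: subset_closure.
Qed.

(** P is chosen to avoid heads `\` U because this makes P `\` U avoid heads
    altogether, so that the orbit of P `\` U is compact. *)
Lemma exists_weak_index_pair (U : set X) :
    open U -> U `<=` N -> inv_part F N `<=` U ->
  exists P : set X * set X, weak_index_pair F N P /\ P.1 `\` P.2 `<=` U.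
Proof.
move=> oU UN; rewrite inv_partE => SU.
have cL : closed (heads `\` U).
  by apply: closedI; [exact: closed_heads|exact: open_closedC].
have [||P [O [cP PN PP PL [oO tO OP]]]] := exists_stable_neighbourhood cL.
- by move=> x [/heads_sub].
- by rewrite -subset0 => x [tx [hx nUx]]; apply: nUx; exact: SU.
pose A := P `\` U.
have AN : A `<=` N by move=> x [/PN].
have cA : compact A by apply: compact_closedI => //; exact: open_closedC.
have Ah : A `&` heads = set0.
  by rewrite -subset0 -PL => x [[Px nUx] hx].
have cQ := compact_orbit_disjoint_heads cA AN Ah.
have PQU : P `\` orbit A `<=` U.
  move=> x [Px nQx]; apply: contrapT => nUx; apply: nQx.
  exact: subset_orbit.
have Qh : orbit A `&` heads = set0.
  rewrite -subset0 => x [[k _ kx] hx].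
  have /(iter_disjoint k AN heads_sub) e : A `&` iter k bwd heads = set0.
    rewrite -subset0 -Ah => y [Ay ky]; split => //; move: ky.
    by apply: iter_bwd_stable => //; exact: bwd_heads.
  by rewrite -e; split.
exists (P, orbit A); split => //; split => //=.
- by apply: orbit_stable => // x [].
- exact: fwd_orbit.
(* A limit of points of F(P) outside P cannot lie in U, as F(P) `&` N `<=` P. *)
- move=> x [clP clFP]; apply: subset_orbit.
  have Px : P x by rewrite ((closure_id _).1 (compact_closed hX cP)).
  split => // Ux.
  have [y [[FPy nPy] Uy]] := clFP U (open_nbhs_nbhs (conj oU Ux)).
  by apply: nPy; apply: PP; split => //; exact: UN.
- rewrite inv_partE => x [tx hx]; rewrite /interior nbhsE.
  exists (O `&` U `&` ~` orbit A).
    split.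
      apply: openI; first exact: openI.
      by apply: closed_openC; exact: compact_closed.
    split; first by split; [exact: tO|exact: SU].
    by move=> Qx; rewrite -[False]/(set0 x) -Qh.
  by move=> y [[Oy Uy] nQy]; split => //; apply: OP; split => //; exact: UN.
- by apply: subset_trans PQU _; rewrite -open_subsetE.
Qed.

End CompactIterates.

Lemma usc_generator {X : topologicalType}
    (Phi : X * discrete_topology int -> set X) :
  usc Phi -> usc (generator Phi).
Proof.
move=> uPhi B cB.
have cP : continuous (fun x : X => (x, 1%R : discrete_topology int)).
  move=> x; apply: (@cvg_pair _ _ _ _ (nbhs x)
    (nbhs (1%R : discrete_topology int)) _ _ _ id _); last exact: cvg_cst.
  exact: cvg_id.
exact: (continuous_closedP _).1 cP _ (uPhi B cB).
Qed.

Local Open Scope ring_scope.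

Theorem theorem4p12 (X : topologicalType) (hX : hausdorff_space X)
    (Phi : X * discrete_topology int -> set X) (hPhi : is_dmds Phi)
    (N : set X) (hN : isolating_neighbourhood (generator Phi) N)
    (W : set X) (hW : inv_part (generator Phi) N `<=` interior W) :
  exists P : set X * set X,
    weak_index_pair (generator Phi) N P /\ P.1 `\` P.2 `<=` W.
Proof.
case: hPhi => uPhi cPhi _ _ invPhi; case: hN => cN SN.
have [| | | | | |P [wP PU]] := @exists_weak_index_pair _ hX (generator Phi) N
    _ _ _ cN (interior N `&` interior W).
- exact: usc_generator.
- by move=> x; exact: cPhi.
- move=> x; suff -> : [set z | generator Phi z x] = Phi (x, -1) by exact: cPhi.
  by apply/seteqP; split => z /=; rewrite /generator => /invPhi.
- by apply: openI; exact: open_interior.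
- by move=> x [/interior_subset].
- by move=> x Sx; split; [exact: SN|exact: hW].
by exists P; split => // x /PU [_ /interior_subset].
Qed.
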